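(* Let $\mathcal{H}$ be a real Hilbert space and let $x_0\in\mathcal{H}$. Suppose $T\colon\mathcal{H}\to\mathcal{H}$ is nonexpansive with $\operatorname{Fix}T\neq\emptyset$ and $\lambda\colon[0,+\infty)\to[0,1]$ is Lebesgue measurable with $\lambda^*:=\inf_{t\geq 0}\lambda(t)>0$. Let $x$ be the unique strong global solution of $$\dot{x}(t)=\lambda(t)\bigl(T(x(t))-x(t)\bigr),\quad x(0)=x_0.$$ If $T$ is boundedly Hölder regular, then there exist $\bar{x}\in\operatorname{Fix}T$, $M>0$ and $\gamma\in(0,1)$ such that, for almost all $t\in[0,+\infty)$, $$\|x(t)-\bar{x}\|\leq M\,t^{-\frac{\gamma}{2(1-\gamma)}}.$$ That is, the trajectory $x(t)$ converges with order $\rho:=\frac{\gamma}{2(1-\gamma)}>0$ to $\bar{x}$ as $t\to+\infty$.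
   Context: $\|\cdot\|$ is the norm induced by the inner product of $\mathcal{H}$. $T$ is nonexpansive if $\|T(u)-T(v)\|\leq\|u-v\|$ for all $u,v\in\mathcal{H}$. $\operatorname{Fix}T=\{u\in\mathcal{H}:T(u)=u\}$. For a set $C\subseteq\mathcal{H}$, $\operatorname{d}(y,C)=\inf_{c\in C}\|y-c\|$. Strong global solution: a map $x\colon[0,+\infty)\to\mathcal{H}$ such that (i) $x$ is absolutely continuous (in the vector-valued sense) on each interval $[0,b]$, $0<b<+\infty$, which implies $x(t)=x(0)+\int_0^t\dot{x}(s)\,ds$ for all $t\in[0,b]$; (ii) $\dot{x}(t)=\lambda(t)(T(x(t))-x(t))$ for almost all $t\in[0,+\infty)$; (iii) $x(0)=x_0$. For every $x_0\in\mathcal{H}$ such a solution exists and is unique (Cauchy--Lipschitz). Regularity: $T$ is Hölder regular on $U\subseteq\mathcal{H}$ if there exist constants $\kappa>0$ and $\gamma\in(0,1)$ such that $\operatorname{d}(y,\operatorname{Fix}T)\leq\kappa\|y-T(y)\|^{\gamma}$ for all $y\in U$. $T$ is boundedly Hölder regular if it is Hölder regular on every bounded subset of $\mathcal{H}$ (the constants $\kappa,\gamma$ may depend on the subset). *)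

(* Defs.v *)
From HB Require Import structures.
From mathcomp Require Import all_boot all_order all_algebra sesquilinear.
From mathcomp Require Import all_classical all_reals all_analysis.

Set Implicit Arguments.
Unset Strict Implicit.
Unset Printing Implicit Defensive.

Import Order.TTheory GRing.Theory Num.Theory.
Import numFieldNormedType.Exports.

Local Open Scope classical_set_scope.
Local Open Scope ring_scope.

(* A real Hilbert space is a complete normed module [H] over [R] with an inner
   product [ip : {dot H for idfun}] that induces the norm of [H]. *)
Definition norm_induced_by (R : realType) (H : normedModType R)
    (ip : {dot H for idfun}) : Prop :=
  forall u : H, `|u| = Num.sqrt (ip u u).

Definition nonexpansive (R : realType) (H : normedModType R)
    (T : H -> H) : Prop :=
  forall u v : H, `|T u - T v| <= `|u - v|.

Definition Fix (H : Type) (T : H -> H) : set H := [set u | T u = u].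

(* The real infimum, so the value is the distance only for nonempty [C]. *)
Definition dist_set (R : realType) (H : normedModType R) (y : H)
    (C : set H) : R :=
  inf [set `|y - c| | c in C].

Definition holder_regular_on (R : realType) (H : normedModType R)
    (T : H -> H) (U : set H) : Prop :=
  exists kappa gamma : R,
    [/\ 0 < kappa, 0 < gamma < 1 &
        forall y, U y -> dist_set y (Fix T) <= kappa * `|y - T y| `^ gamma].

Definition boundedly_holder_regular (R : realType) (H : normedModType R)
    (T : H -> H) : Prop :=
  forall U : set H, bounded_set U -> holder_regular_on T U.

(* Measurability for the sigma-algebra of Lebesgue (Caratheodory) measurable
   sets, the domain of [completed_lebesgue_measure], which is larger than the
   Borel one carried by [measurableTypeR R]. *)
Definition lebesgue_measurable_fun (R : realType) (D : set R)
    (f : R -> R) : Prop :=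
  @measurable_fun _ _ (caratheodory_type (@wlength R idfun)^*%mu)
    (measurableTypeR R) D f.

(* The intervals of the family [I] may be degenerate: such an interval adds
   nothing to either sum. *)
Definition absolutely_continuous_on (R : realType) (H : normedModType R)
    (a b : R) (f : R -> H) : Prop :=
  forall eps : R, 0 < eps -> exists2 delta : R, 0 < delta &
    forall (n : nat) (I : 'I_n -> R * R),
      (forall i, a <= (I i).1 /\ (I i).1 <= (I i).2 /\ (I i).2 <= b) ->
      trivIset [set: 'I_n] (fun i => `](I i).1, (I i).2[%classic) ->
      \sum_(i < n) ((I i).2 - (I i).1) < delta ->
      \sum_(i < n) `|f (I i).2 - f (I i).1| < eps.

(* A function on [0, +oo[ is a total function on [R] whose values at negative
   arguments are irrelevant; the two-sided derivative sees them only at the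
   negligible point [t = 0]. *)
Definition strong_global_solution (R : realType) (H : normedModType R)
    (T : H -> H) (lambda : R -> R) (x0 : H) (x : R -> H) : Prop :=
  [/\ forall b : R, 0 < b -> absolutely_continuous_on 0 b x,
      {ae (@lebesgue_measure R), forall t : R, 0 <= t ->
         is_derive t 1 x (lambda t *: (T (x t) - x t))} &
      x 0 = x0].

(* Main.v *)
(** For a fixed point c, [|x t - c|^2] is absolutely continuous with derivative
    [2 lambda <T x - x, x - c> <= - l |x - T x|^2] almost everywhere, where
    [l = inf lambda]. Hence x is Fejer monotone with respect to [Fix T] and
    [d t = dist (x t) (Fix T)] is nonincreasing, so on [[s, t]] Hoelder
    regularity bounds the residual below by a multiple of [(d t)^(1/gamma)].
    Integrating and taking the infimum over c, [D = d^2] satisfies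
    [D t + A (D t)^(1/gamma) (t - s) <= D s] for [s <= t]; this discrete form
    of a Bernoulli inequality gives the rate of D by doubling t, without
    differentiating d. Fejer monotonicity makes x Cauchy with a limit at
    distance at most [2 d t] from [x t]. *)
Require Import Defs.
From mathcomp Require Import all_boot all_order all_algebra sesquilinear.
From mathcomp Require Import all_classical all_reals all_analysis.
From mathcomp Require Import measurable_realfun ring lra.

Import Order.TTheory GRing.Theory Num.Theory.
Import numFieldNormedType.Exports.

Local Open Scope classical_set_scope.
Local Open Scope ring_scope.

(** * Mean value inequality under an almost everywhere bound on the derivative *)

(** At the supremum [c] of the points of [[a, b]] where [P] holds, the step carries [P] from a point
    just left of [c] to [min b (c + r / 2)]. This point must be [b], because no point beyond [c]
    qualifies. *)
Lemma segment_induction (R : realType) (a b : R) (P : R -> Prop) :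
  a <= b -> P a ->
  (forall c, a <= c <= b -> exists2 r, 0 < r &
    forall t v, a <= t <= c -> c <= v <= b -> c - r < t -> v < c + r ->
      P t -> P v) ->
  P b.
Proof.
move=> ab Pa step.
pose S := [set t | a <= t <= b /\ P t].
have Sa : S a by split=> //; rewrite lexx.
have supS : has_sup S by split; [exists a | exists b => t [/andP[]]].
have ac : a <= sup S by apply: ub_le_sup => //; case: supS.
have cb : sup S <= b by apply: ge_sup; [exists a | move=> t [/andP[]]].
have [|r r0 Hr] := step (sup S); first by rewrite ac.
have [t [/andP[at_ tb] Pt] ct] := sup_adherent r0 supS.
have tc : t <= sup S by apply: ub_le_sup; [case: supS|rewrite /S /= at_ tb].
pose v := Num.min b (sup S + r / 2).
have cv : sup S <= v by rewrite le_min cb lerDl; lra.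
have vb : v <= b by rewrite ge_min lexx.
have Pv : P v.
  apply: (Hr t v) => //; rewrite ?at_ ?tc ?cv ?vb //.
  have : v <= sup S + r / 2 by rewrite ge_min lexx orbT.
  by lra.
have vc : v <= sup S.
  by apply: ub_le_sup; [case: supS|split=> //; rewrite vb (le_trans ac)].
have [bv|bv] := leP b (sup S + r / 2).
  by move: Pv; rewrite /v min_l.
by move: vc; rewrite /v min_r ?(ltW bv)//; lra.
Qed.

(** Converts the measure of an open cover of a null set into the smallness condition of absolute
    continuity. *)
Lemma sum_disjoint_itv_lt (R : realType) (n : nat) (I : 'I_n -> R * R)
    (U : set R) (d : R) :
  open U -> (lebesgue_measure U < d%:E)%E ->
  (forall i, (I i).1 <= (I i).2) ->
  (forall i, `](I i).1, (I i).2[%classic `<=` U) ->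
  trivIset [set: 'I_n] (fun i => `](I i).1, (I i).2[%classic) ->
  \sum_(i < n) ((I i).2 - (I i).1) < d.
Proof.
move=> oU Ud le12 sub tri.
rewrite -lte_fin -sumEFin; apply: le_lt_trans Ud.
pose F (i : 'I_n) : set (measurableTypeR R) := `](I i).1, (I i).2[%classic.
have mF i : measurable (F i) by exact: measurable_itv.
under eq_bigr => i _.
  have -> : (((I i).2 - (I i).1)%:E)%E = (lebesgue_measure (F i) : \bar R).
    rewrite /F lebesgue_measure_itv /= lte_fin.
    by case: ltgtP (le12 i) => // ->; rewrite subrr.
  over.
rewrite -measure_bigsetU_ord //.
apply: le_measure; rewrite ?inE.
- by apply: bigsetU_measurable => i _; exact: mF.
- exact: open_measurable.
- apply: (big_ind (fun A => A `<=` U)) => [|A B AU BU|i _].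
  + exact: sub0set.
  + by rewrite subUset.
  + exact: sub.
Qed.

(** The increments from [u] to [t] and from [t] to [v] are compared separately with the difference
    quotient at [t], then added. Points on both sides of [t] are what segment induction asks for. *)
Lemma is_derive_le_increment (R : realType) (f : R -> R^o) (t k e df : R) :
  0 < e -> df <= k -> is_derive t 1 f df ->
  exists2 r, 0 < r & forall u v, t - r < u -> u <= t -> t <= v -> v < t + r ->
    f v - f u <= (k + e) * (v - u).
Proof.
move=> e0 dfk [dft dfE].
have cv : h^-1 *: (f (h *: 1 + t) - f t) @[h --> 0^'] --> df.
  by rewrite -dfE; exact: dft.
have : \forall h \near 0^', h^-1 *: (f (h *: 1 + t) - f t) < k + e.
  by apply: (cvgr_lt _ cv); lra.
move=> /nbhs_ballP[r /= r0 Hr].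
have H h : `|h| < r -> h != 0 -> h^-1 * (f (h + t) - f t) < k + e.
  move=> hr h0; have := Hr h; rewrite /ball /= sub0r normrN => /(_ hr h0).
  by rewrite /GRing.scale /= mulr1.
exists r => // u v ru ut tv vr.
have Hv : f v - f t <= (k + e) * (v - t).
  move: tv; rewrite le_eqVlt => /predU1P[->|tv]; first by rewrite !subrr mulr0.
  have := H (v - t); rewrite subrK gtr0_norm ?subr_gt0// => /(_ _ _)/ltW.
  rewrite ler_pdivrMl ?subr_gt0// mulrC; apply; first by lra.
  by rewrite subr_eq0 gt_eqF.
have Hu : f t - f u <= (k + e) * (t - u).
  move: ut; rewrite le_eqVlt => /predU1P[->|ut]; first by rewrite !subrr mulr0.
  have := H (u - t); rewrite subrK ltr0_norm ?subr_lt0// opprB => /(_ _ _)/ltW.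
  rewrite ler_ndivrMl ?subr_lt0// => /(_ _ _) Hh.
  have : (u - t) * (k + e) <= f u - f t.
    by apply: Hh; [lra|rewrite subr_eq0 lt_eqF].
  by lra.
by lra.
Qed.

(* Cover the exceptional null set by an open U of small measure. By induction
   along [[a, b]], [f t - f a] is at most [(k + e) * (t - a)] plus the sum of
   [|f v - f u| + |k + e| * (v - u)] over finitely many disjoint intervals
   [(u, v)] inside U, which absolute continuity makes small. *)
Lemma ae_derive_le_increment (R : realType) (f : R -> R^o) (a b k : R) :
  a <= b -> absolutely_continuous_on a b f ->
  {ae (@lebesgue_measure R), forall t : R, a <= t <= b ->
     exists2 df : R, df <= k & is_derive t 1 f df} ->
  f b - f a <= k * (b - a).
Proof.
move=> ab acf [N [mN N0 subN]].
(* The slope [k + e] costs [e * (b - a)]. One further [e] bounds the variation of [f] over the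
   intervals inside the cover, the other their total length times [m]. *)
suff H e : 0 < e -> f b - f a <= k * (b - a) + e * (b - a + 2).
  apply/ler_addgt0Pr => e e0.
  have := H (e / (b - a + 2)); rewrite divfK; last by apply/eqP; lra.
  by apply; rewrite divr_gt0 //; lra.
move=> e0.
have [d d0 Hd] := acf e e0.
pose m := `|k + e|; have m0 : 0 <= m by exact: normr_ge0.
pose d' := Num.min d (e / (m + 1)).
have d'0 : 0 < d' by rewrite lt_min d0 divr_gt0 //; lra.
have [|U [oU NU Ud]] := @lebesgue_regularity_outer R N d' mN _ d'0.
  by rewrite [X in (X < _)%E]N0.
have mU : (lebesgue_measure U < d'%:E)%E.
  rewrite (measureDI lebesgue_measure _ mN); last exact: open_measurable.
  rewrite [X in (_ + X)%E](_ : _ = 0%E) ?adde0 //.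
  apply: (subset_measure0 (B := N)) => //.
  by apply: measurableI => //; exact: open_measurable.
pose g (p : R * R) := `|f p.2 - f p.1| + m * (p.2 - p.1).
pose P t := exists s : seq (R * R),
  [/\ forall p, p \in s ->
        [/\ a <= p.1, p.1 <= p.2, p.2 <= t & `]p.1, p.2[%classic `<=` U],
      pairwise (fun p q => q.2 <= p.1) s &
      f t - f a <= (k + e) * (t - a) + \sum_(p <- s) g p].
have {subN} step c : a <= c <= b -> exists2 r, 0 < r &
    forall t v, a <= t <= c -> c <= v <= b -> c - r < t -> v < c + r ->
      P t -> P v.
  move=> acb; have [Nc|Nc] := pselect (N c).
    have /nbhs_ballP[r /= r0 Hr] := open_nbhs_nbhs (conj oU (NU _ Nc)).
    exists r => // t v /andP[at_ tc] /andP[cv vb] rt vr [s [s1 s2 s3]].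
    (* The new interval lies to the right of the earlier ones and becomes the head, so the list runs
       from right to left. *)
    exists ((t, v) :: s); split => [p|/=|].
    - rewrite inE => /predU1P[->|/s1[? ? pt ?]] /=.
        split => //=; first by lra.
        move=> y /=; rewrite in_itv /= => /andP[ty yv]; apply: Hr.
        by rewrite /ball /= ltr_distlC; apply/andP; lra.
      by split => //; lra.
    - by rewrite s2 andbT; apply/allP => q /s1[].
    - rewrite big_cons /g /=; have := ler_norm (f v - f t).
      (* The slope [k + e] may be negative; the term of [g] with factor [m] pays for
         [(k + e) * (v - t)] in that case. *)
      have : - (k + e) * (v - t) <= m * (v - t).
        by apply: ler_wpM2r; [lra|have := ler_norm (- (k + e)); rewrite normrN].
      by move: s3; rewrite /g /=; lra.
  have [df dfk fc] : exists2 df : R, df <= k & is_derive c 1 f df.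
    by apply: contrapT => H; apply: Nc; apply: subN => /= Hc; exact: H (Hc acb).
  have [r r0 Hr] := is_derive_le_increment _ _ _ _ _ _ e0 dfk fc.
  exists r => // t v /andP[at_ tc] /andP[cv vb] rt vr [s [s1 s2 s3]].
  exists s; split => //.
    by move=> p /s1[]; split => //; lra.
  by have := Hr t v rt tc cv vr; lra.
have Pa : P a.
  by exists [::]; split => //; rewrite big_nil !subrr mulr0 addr0.
have [s [s1 s2 s3]] := segment_induction _ _ _ _ ab Pa step.
pose I (i : 'I_(size s)) := nth (0, 0) s i.
have sI i : I i \in s by apply: mem_nth.
have I12 i : (I i).1 <= (I i).2 by have [] := s1 _ (sI i).
have Itri : trivIset [set: 'I_(size s)] (fun i => `](I i).1, (I i).2[%classic).
  have ord (i j : 'I_(size s)) : (i < j)%N -> (I j).2 <= (I i).1.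
    by have /(pairwiseP (0, 0)) := s2; apply; rewrite inE ltn_ord.
  move=> i j _ _ [y [/=]]; rewrite !in_itv /= => /andP[iy yi] /andP[jy yj].
  by apply: val_inj; case: (ltngtP i j) => // /ord ij; exfalso; lra.
have Id' : \sum_(i < size s) ((I i).2 - (I i).1) < d'.
  by apply: (sum_disjoint_itv_lt _ _ _ U) => // i; have [] := s1 _ (sI i).
have Ie : \sum_(i < size s) `|f (I i).2 - f (I i).1| < e.
  apply: Hd => //; last by apply: lt_le_trans Id' _; rewrite ge_min lexx.
  by move=> i; have [? ? ? _] := s1 _ (sI i).
have Im : m * \sum_(i < size s) ((I i).2 - (I i).1) <= e.
  apply: (@le_trans _ _ (m * (e / (m + 1)))).
    apply: ler_wpM2l => //; apply: le_trans (ltW Id') _.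
    by rewrite ge_min lexx orbT.
  by rewrite mulrCA ger_pMr // ler_pdivrMr; lra.
move: s3; rewrite (big_nth (0, 0)) big_mkord /g big_split /= -mulr_sumr.
by rewrite -/I; lra.
Qed.

(** * Decay rate from the discrete Bernoulli inequality *)

(** Put [q = 1 / (p - 1)] and [y = C * t ^ (- q)]. If [D t > y] while the bound holds at [t / 2],
    then [D (t / 2) <= 2 ^ q * y], but the drop over [[t / 2, t]] is at least
    [A * y ^ p * t / 2 >= 2 ^ q * y], which leaves nothing for [D t]. *)
Lemma powR_decay (R : realType) (D : R -> R) (A p : R) :
  0 < A -> 1 < p -> (forall t, 0 <= t -> 0 <= D t) ->
  (forall s t, 0 <= s -> s <= t -> D t + A * D t `^ p * (t - s) <= D s) ->
  exists2 C, 0 < C & forall t, 0 < t -> D t <= C * t `^ (- (p - 1)^-1).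
Proof.
move=> A0 p1 D0 Ddec.
pose q := (p - 1)^-1; have q0 : 0 < q by rewrite invr_gt0; lra.
have qp : q * (p - 1) = 1 by rewrite mulVf//; lra.
pose B := 2 * 2 `^ q / A.
have B0 : 0 < B by rewrite divr_gt0 // mulr_gt0 // powR_gt0.
(* The first entry settles [t <= 1], where [t ^ (- q) >= 1]; the second makes the halving step
   work. *)
pose C := Num.max (D 0 + 1) (B `^ q).
have C0 : 0 < C by rewrite lt_max powR_gt0 ?orbT.
have CB : 2 * 2 `^ q <= A * C `^ (p - 1).
  rewrite [leRHS]mulrC -ler_pdivrMr // -/B.
  have -> : B = (B `^ q) `^ (p - 1) by rewrite -powRrM qp powRr1 // ltW.
  apply: ge0_ler_powR; rewrite ?nnegrE ?powR_ge0 ?(ltW C0) //; first by lra.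
  by rewrite le_max lexx orbT.
(* [C] is so large that [D t > C t^-q] contradicts the bound at [t / 2]. *)
exists C => // t t0; rewrite -/q.
have [n tn] : exists n : nat, t <= 2 ^+ n.
  exists (Num.bound t); apply: le_trans (ltW (archi_boundP (ltW t0))) _.
  by rewrite -natrX ler_nat ltnW // ltn_expl.
(* Induction on the number of halvings that bring [t] down to at most 1. *)
elim: n t t0 tn => [|n IH] t t0 tn.
  have tq : 1 <= t `^ (- q).
    rewrite powRN invf_ge1 ?powR_gt0 //.
    have -> : 1 = 1 `^ q :> R by rewrite powR1.
    by apply: ge0_ler_powR; rewrite ?nnegrE ?(ltW q0) ?(ltW t0).
  apply: (@le_trans _ _ (D 0)).
    have := Ddec 0 t (lexx _) (ltW t0).
    have : 0 <= A * D t `^ p * (t - 0).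
      by rewrite subr0 !mulr_ge0 ?powR_ge0 // ltW.
    by lra.
  have : D 0 + 1 <= C by rewrite le_max lexx.
  have : C <= C * t `^ (- q) by rewrite ler_peMr // ltW.
  by lra.
pose y := C * t `^ (- q).
have y0 : 0 < y by rewrite mulr_gt0 ?powR_gt0.
rewrite leNgt; apply/negP => yD.
have Dhalf : D (t / 2) <= y * 2 `^ q.
  apply: le_trans (IH _ _ _) _; [by rewrite divr_gt0|..].
    by rewrite ler_pdivrMr // -exprSr.
  have -> : 2 `^ q = 2^-1 `^ (- q) :> R.
    by rewrite -powR_inv1 // -powRrM mulN1r opprK.
  by rewrite -/q powRM ?invr_ge0 ?(ltW t0) // mulrA.
have yp : y * C `^ (p - 1) / t <= D t `^ p.
  (* [y ^ (p - 1) = C ^ (p - 1) / t], because [q * (p - 1) = 1]. *)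
  have -> : y * C `^ (p - 1) / t = y `^ p.
    have -> : y `^ p = y `^ (1 + (p - 1)) by congr powR; lra.
    rewrite [RHS]powRD ?(gt_eqF y0) ?implybT // powRr1 ?(ltW y0) // -mulrA.
    congr *%R.
    rewrite /y [RHS]powRM ?powR_ge0 ?(ltW C0) // -powRrM mulNr qp.
    by rewrite powR_inv1 // ltW.
  apply: ge0_ler_powR; rewrite ?nnegrE ?D0 ?(ltW y0) ?(ltW t0) ?(ltW yD) //.
  by lra.
have Dt : D t + A * D t `^ p * (t - t / 2) <= D (t / 2) by apply: Ddec; lra.
have h1 : A * (y * C `^ (p - 1) / t) * (t / 2) <= A * D t `^ p * (t / 2).
  by apply: ler_wpM2r; [lra|apply: ler_wpM2l => //; exact: ltW].
have h2 : A * (y * C `^ (p - 1) / t) * (t / 2) = y * (A * C `^ (p - 1)) / 2.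
  by field; lra.
have h3 : y * (2 * 2 `^ q) <= y * (A * C `^ (p - 1)).
  by apply: ler_wpM2l => //; exact: ltW.
move: Dt; have -> : t - t / 2 = t / 2 by lra.
apply/negP; rewrite -ltNge.
apply: le_lt_trans Dhalf _.
have -> : y * 2 `^ q = y * (2 * 2 `^ q) / 2 by field.
apply: (@lt_le_trans _ _ (D t + y * (2 * 2 `^ q) / 2)).
  by rewrite ltrDr (lt_trans y0 yD).
by rewrite lerD2l; apply: le_trans h1; rewrite h2 ler_pM2r ?invr_gt0.
Qed.

(** * Distance to a set *)

Lemma dist_set_le (R : realType) (H : normedModType R) (y : H) (C : set H)
    (c : H) : C c -> dist_set y C <= `|y - c|.
Proof.
move=> Cc; apply: ge_inf; last by exists c.
by exists 0 => _ [d _ <-].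
Qed.

Lemma le_dist_set (R : realType) (H : normedModType R) (y : H) (C : set H)
    (m : R) :
  C !=set0 -> (forall c, C c -> m <= `|y - c|) -> m <= dist_set y C.
Proof.
move=> [c Cc] Hm; apply: lb_le_inf; first by exists `|y - c|, c.
by move=> _ [d Cd <-]; exact: Hm.
Qed.

Lemma dist_set_ge0 (R : realType) (H : normedModType R) (y : H) (C : set H) :
  C !=set0 -> 0 <= dist_set y C.
Proof. by move=> C0; apply: le_dist_set. Qed.

Lemma dist_set_lt (R : realType) (H : normedModType R) (y : H) (C : set H)
    (m : R) :
  C !=set0 -> dist_set y C < m -> exists2 c, C c & `|y - c| < m.
Proof.
move=> C0 dm; apply: contrapT => nex; move: dm; apply/negP; rewrite -leNgt.
apply: le_dist_set => // c Cc; rewrite leNgt; apply/negP => cm.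
by apply: nex; exists c.
Qed.

(** * Absolutely continuous curves *)

Lemma absolutely_continuous_onS (R : realType) (H : normedModType R)
    (a b c d : R) (f : R -> H) :
  a <= c -> d <= b ->
  absolutely_continuous_on a b f -> absolutely_continuous_on c d f.
Proof.
move=> ac db acf e /acf[r r0 Hr]; exists r => // n I HI.
by apply: Hr => i; have [? [? ?]] := HI i; lra.
Qed.

Lemma absolutely_continuous_on_uniform (R : realType) (H : normedModType R)
    (a b : R) (f : R -> H) (e : R) :
  absolutely_continuous_on a b f -> 0 < e ->
  exists2 d, 0 < d & forall u v, a <= u -> u <= v -> v <= b -> v - u < d ->
    `|f v - f u| < e.
Proof.
move=> acf /acf[d d0 Hd]; exists d => // u v au uv vb vu.
have := Hd 1%N (fun=> (u, v)); rewrite !big_ord1 /=; apply => //.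
by move=> i j _ _ _; rewrite !ord1.
Qed.

(** Uniform continuity gives a length [d] over which [f] moves by less than 1, so segment induction
    propagates a bound that grows by 1 at each step. *)
Lemma absolutely_continuous_on_bounded (R : realType) (H : normedModType R)
    (a b : R) (f : R -> H) :
  a <= b -> absolutely_continuous_on a b f ->
  exists M, forall t, a <= t <= b -> `|f t| <= M.
Proof.
move=> ab acf.
have [d d0 Hd] := absolutely_continuous_on_uniform _ _ _ _ _ _ acf ltr01.
pose P t := exists M, forall u, a <= u <= t -> `|f u| <= M.
apply: (segment_induction _ a b P) => //.
  by exists `|f a| => u; rewrite -eq_le => /eqP ->.
move=> c acb; exists (d / 2); first by lra.
move=> t v /andP[at_ tc] /andP[cv vb] rt vr [M HM].
exists (M + 1) => u /andP[au uv]; have [ut|tu] := leP u t.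
  by have := HM u; rewrite au ut => /(_ isT); lra.
have := Hd t u at_ (ltW tu); have := ler_normD (f u - f t) (f t).
have := HM t; rewrite at_ lexx subrK => /(_ isT) h1 h2 /(_ _ _) h3.
have : `|f u - f t| < 1 by apply: h3; lra.
by lra.
Qed.

(** * Squared distances in a Hilbert space *)

Lemma sqr_norm_ip (R : realType) (H : normedModType R)
    (ip : {dot H for idfun}) :
  norm_induced_by ip -> forall u : H, `|u| ^+ 2 = ip u u.
Proof.
move=> hip u; rewrite hip sqr_sqrtr //.
have [->|u0] := eqVneq u 0; first by rewrite linear0l.
by rewrite ltW // neq0_dnorm_gt0.
Qed.

Lemma dotDl (R : realType) (H : normedModType R) (ip : {dot H for idfun})
    (u v w : H) : ip (u + v) w = ip u w + ip v w.
Proof. exact: linearDl. Qed.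

Lemma dotDr (R : realType) (H : normedModType R) (ip : {dot H for idfun})
    (u v w : H) : ip u (v + w) = ip u v + ip u w.
Proof. exact: linearDr. Qed.

Lemma dotZl (R : realType) (H : normedModType R) (ip : {dot H for idfun})
    (a : R) (u v : H) : ip (a *: u) v = a * ip u v.
Proof. exact: linearZl_LR. Qed.

Lemma sqr_normD (R : realType) (H : normedModType R)
    (ip : {dot H for idfun}) :
  norm_induced_by ip ->
  forall u v : H, `|u + v| ^+ 2 = `|u| ^+ 2 + 2 * ip u v + `|v| ^+ 2.
Proof.
move=> hip u v; rewrite !(sqr_norm_ip _ _ _ hip) dotDl !dotDr.
have -> : ip v u = ip u v by rewrite hermC /= expr0 mul1r.
by ring.
Qed.

(** With [q h] the difference quotient of [x] at [t] and [a = x t - c], that of the squared distance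
    is [h * |q h|^2 + 2 * ip (q h) a]. *)
Lemma is_derive_sqr_norm (R : realType) (H : normedModType R)
    (ip : {dot H for idfun}) (x : R -> H) (c v : H) (t : R) :
  norm_induced_by ip -> is_derive t 1 x v ->
  is_derive t 1 (fun s => `|x s - c| ^+ 2 : R^o) (2 * ip v (x t - c)).
Proof.
move=> hip [dx dxE].
have cv : h^-1 *: (x (h *: 1 + t) - x t) @[h --> 0^'] --> v.
  by rewrite -dxE; exact: dx.
set a := x t - c.
pose q h := h^-1 *: (x (h *: 1 + t) - x t).
have ipE w : 2 * ip w a = `|w + a| ^+ 2 - `|w| ^+ 2 - `|a| ^+ 2.
  by rewrite (sqr_normD _ _ _ hip); lra.
(* The difference quotient is written with norms only, so that continuity of
   the norm replaces continuity of [ip]. *)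
have lim : h * `|q h| ^+ 2 + (`|q h + a| ^+ 2 - `|q h| ^+ 2 - `|a| ^+ 2)
    @[h --> 0^'] --> (2 * ip v a : R^o).
  have -> : 2 * ip v a =
      0 * `|v| ^+ 2 + (`|v + a| ^+ 2 - `|v| ^+ 2 - `|a| ^+ 2).
    by rewrite mul0r add0r ipE.
  have cq : `|q h| ^+ 2 @[h --> 0^'] --> `|v| ^+ 2.
    rewrite expr2; under eq_cvg do rewrite expr2.
    by apply: cvgM; exact: cvg_norm.
  have cqa : `|q h + a| ^+ 2 @[h --> 0^'] --> `|v + a| ^+ 2.
    rewrite expr2; under eq_cvg do rewrite expr2.
    by apply: cvgM; apply: cvg_norm; apply: cvgD => //; exact: cvg_cst.
  apply: cvgD; first by apply: cvgM => //; exact: cvg_within.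
  by apply: cvgB; [exact: cvgB|exact: cvg_cst].
have quot : h^-1 *: (`|x (h *: 1 + t) - c| ^+ 2 - `|x t - c| ^+ 2 : R^o)
    @[h --> 0^'] --> (2 * ip v a : R^o).
  apply: cvg_trans lim; apply: near_eq_cvg; near=> h.
  have h0 : h != 0 by near: h; exact: nbhs_dnbhs_neq.
  have -> : x (h *: 1 + t) - c = h *: q h + a.
    by rewrite /q scalerA mulfV // scale1r /a addrA subrK.
  rewrite [`|h *: q h + a| ^+ 2](sqr_normD _ _ _ hip) dotZl.
  rewrite -ipE [`|h *: q h|]normrZ exprMn /GRing.scale /=.
  rewrite real_normK ?num_real // -/a.
  by field.
split; first by apply/cvg_ex; exists (2 * ip v a).
by apply: cvg_lim => //.
Unshelve. all: by end_near.
Qed.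

(** Expand the square of [T y - c = (T y - y) + (y - c)] in [|T y - c|^2 <= |y - c|^2]. *)
Lemma nonexpansive_ip_le (R : realType) (H : normedModType R)
    (ip : {dot H for idfun}) (T : H -> H) (y c : H) :
  norm_induced_by ip -> nonexpansive T -> Fix T c ->
  2 * ip (T y - y) (y - c) <= - `|T y - y| ^+ 2.
Proof.
move=> hip nT fc; have := nT y c; rewrite fc => h.
have : `|T y - c| ^+ 2 <= `|y - c| ^+ 2 by rewrite ler_sqr ?nnegrE.
have -> : T y - c = (T y - y) + (y - c) by rewrite addrA subrK.
by rewrite (sqr_normD _ _ _ hip); lra.
Qed.

Lemma absolutely_continuous_on_sqr_norm (R : realType) (H : normedModType R)
    (a b : R) (x : R -> H) (c : H) :
  a <= b -> absolutely_continuous_on a b x ->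
  absolutely_continuous_on a b (fun s => `|x s - c| ^+ 2 : R^o).
Proof.
move=> ab acx; have [M HM] := absolutely_continuous_on_bounded _ _ _ _ _ ab acx.
have M0 : 0 <= M by apply: le_trans (HM a _); rewrite ?lexx.
(* Bounds the second factor in the difference of two squares; the 1 keeps it positive for the
   division of [e]. *)
pose B := 2 * (M + `|c|) + 1.
have B0 : 0 < B by have := normr_ge0 c; rewrite /B; lra.
move=> e e0; have [d d0 Hd] := acx (e / B) (divr_gt0 e0 B0).
exists d => // n I HI tI sI.
have := Hd n I HI tI sI; rewrite ltr_pdivlMr // mulr_suml.
apply: le_lt_trans; apply: ler_sum => i _.
have [h1 [h2 h3]] := HI i.
rewrite subr_sqr normrM; apply: ler_pM => //.
  by apply: le_trans (ler_dist_dist _ _) _; rewrite opprB addrA subrK.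
have b1 := ler_normB (x (I i).2) c; have b2 := ler_normB (x (I i).1) c.
have m1 : `|x (I i).2| <= M by apply: HM; lra.
have m2 : `|x (I i).1| <= M by apply: HM; lra.
rewrite ger0_norm ?addr_ge0 // /B; lra.
Qed.

(** * Decrease of the squared distance along the trajectory *)

(** The constant [K] is left free for two uses: [K = 0] gives Fejer monotonicity, and the Hoelder
    lower bound on the residual gives the decay inequality. *)
Lemma strong_solution_decrease (R : realType) (H : normedModType R)
    (ip : {dot H for idfun}) (T : H -> H) (lambda : R -> R) (x0 : H)
    (x : R -> H) (c : H) (l K s t : R) :
  norm_induced_by ip -> nonexpansive T ->
  (forall u, 0 <= u -> l <= lambda u) -> 0 <= l ->
  strong_global_solution T lambda x0 x -> Fix T c ->
  0 <= s -> s <= t ->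
  (forall u, s <= u <= t -> K <= l * `|x u - T (x u)| ^+ 2) ->
  `|x t - c| ^+ 2 + K * (t - s) <= `|x s - c| ^+ 2.
Proof.
move=> hip nT ll l0 [acx dx _] fc s0 st HK.
suff : `|x t - c| ^+ 2 - `|x s - c| ^+ 2 <= - K * (t - s) by lra.
apply: (ae_derive_le_increment _ (fun s => `|x s - c| ^+ 2 : R^o)) => //.
  apply: absolutely_continuous_on_sqr_norm => //.
  (* The endpoint [t + 1] is positive even when [t = 0], as absolute continuity of a solution
     requires. *)
  apply: (absolutely_continuous_onS _ _ 0 (t + 1)) => //; first by lra.
  by apply: acx; lra.
apply: negligibleS dx; apply: subsetC => u /= du ust; have u0 : 0 <= u by lra.
exists (2 * ip (lambda u *: (T (x u) - x u)) (x u - c)).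
  have h1 := HK u ust; have h2 := ll u u0.
  have h3 := nonexpansive_ip_le _ _ _ _ (x u) _ hip nT fc.
  rewrite dotZl mulrCA; rewrite distrC in h1.
  have h4 : l * `|T (x u) - x u| ^+ 2 <= lambda u * `|T (x u) - x u| ^+ 2.
    by apply: ler_wpM2r => //; exact: sqr_ge0.
  have h5 : lambda u * (2 * ip (T (x u) - x u) (x u - c)) <=
     lambda u * - `|T (x u) - x u| ^+ 2.
    by apply: ler_wpM2l => //; lra.
  by lra.
by apply: is_derive_sqr_norm => //; exact: du.
Qed.

(** Raise the regularity inequality to the power [1 / gamma] and square it. *)
Lemma holder_residual_ge (R : realType) (d kappa gamma r : R) :
  0 < kappa -> 0 < gamma -> 0 <= d -> 0 <= r -> d <= kappa * r `^ gamma ->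
  (d ^+ 2) `^ gamma^-1 <= (kappa `^ gamma^-1) ^+ 2 * r ^+ 2.
Proof.
move=> k0 g0 d0 r0 dr.
have h : d `^ gamma^-1 <= kappa `^ gamma^-1 * r.
  have -> : r = (r `^ gamma) `^ gamma^-1.
    by rewrite -powRrM mulfV ?gt_eqF // powRr1.
  rewrite -powRM ?powR_ge0 ?(ltW k0) //; apply: ge0_ler_powR => //.
  - by rewrite invr_ge0 ltW.
  - by rewrite nnegrE mulr_ge0 ?powR_ge0 ?ltW.
rewrite expr2 powRM // -expr2 -exprMn ler_sqr ?nnegrE ?powR_ge0 //.
by rewrite mulr_ge0 ?powR_ge0.
Qed.

(** * Passage to the limit *)

Lemma powRN_lt (R : realType) (M a e : R) :
  0 < M -> 0 < a -> 0 < e -> exists2 t, 0 < t & M * t `^ (- a) < e.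
Proof.
move=> M0 a0 e0; pose B := M / e + 1.
have B0 : 0 < B by rewrite addr_gt0 // divr_gt0.
exists (B `^ a^-1); first exact: powR_gt0.
rewrite -powRrM mulrN mulVf ?gt_eqF // powR_inv1 ?ltW //.
rewrite ltr_pdivrMr // /B mulrDr mulrCA divff ?gt_eqF // !mulr1.
by rewrite ltrDl.
Qed.

(** For [c] in [C] and [s <= t], going through [c] gives [|x s - x t| <= 2 * |x s - c|]. The infimum
    over [c] yields the Cauchy property, and the limit in [t] yields the bound. *)
Lemma fejer_cvg (R : realType) (H : completeNormedModType R)
    (C : set H) (x : R -> H) :
  C !=set0 ->
  (forall c s t, C c -> 0 <= s -> s <= t -> `|x t - c| <= `|x s - c|) ->
  (forall e, 0 < e -> exists2 t, 0 < t & dist_set (x t) C < e) ->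
  exists xbar : H, forall t, 0 <= t -> `|x t - xbar| <= 2 * dist_set (x t) C.
Proof.
move=> C0 fejer d0.
have close s t : 0 <= s -> s <= t -> `|x s - x t| <= 2 * dist_set (x s) C.
  move=> s0 st; rewrite mulrC -ler_pdivrMr //; apply: le_dist_set => // c Cc.
  rewrite ler_pdivrMr // mulr2n mulrDr mulr1.
  apply: le_trans (ler_distD c _ _) _.
  by rewrite lerD2l distrC; exact: fejer.
have : cvg (x t @[t --> +oo]).
  apply: cauchy_cvg; apply: cauchy_exP => e e0.
  have [t t0 td] := d0 (e / 2) (divr_gt0 e0 (ltr0Sn _ _)).
  exists (x t); suff : \forall u \near +oo, ball (x t) e (x u) by [].
  near=> u; rewrite -ball_normE /=.
  apply: le_lt_trans (close t u (ltW t0) _) _; last by lra.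
  by near: u; apply: nbhs_pinfty_ge; exact: num_real.
move=> /cvg_ex[xbar xl]; exists xbar => t t0.
apply/ler_addgt0Pr => e e0.
have xe : \forall s \near +oo, `|xbar - x s| < e.
  by apply: (@cvgr_dist_lt _ H _ _ _ x xbar).
near (pinfty_nbhs R) => s.
have ts : t <= s by near: s; apply: nbhs_pinfty_ge; exact: num_real.
have sl : `|xbar - x s| < e by near: s.
apply: le_trans (ler_distD (x s) _ _) _; rewrite (distrC _ xbar).
by rewrite lerD ?close // ltW.
Unshelve. all: by end_near.
Qed.

(** Closedness of [Fix T]: [|T y - y| <= |T y - T c| + |c - y| <= 2 * |y - c|]. *)
Lemma Fix_dist0 (R : realType) (H : normedModType R) (T : H -> H) (y : H) :
  nonexpansive T ->
  (forall e, 0 < e -> exists2 c, Fix T c & `|y - c| < e) -> Fix T y.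
Proof.
move=> nT close_to_fix; apply/eqP; rewrite -subr_eq0 -normr_le0.
apply/ler_addgt0Pr => e e0; rewrite add0r.
have [c fc yc] := close_to_fix (e / 2) (divr_gt0 e0 (ltr0Sn _ _)).
apply: le_trans (ler_distD c _ _) _.
by have := nT y c; rewrite fc (distrC c); lra.
Qed.

(** * Convergence rate of the trajectory *)

Theorem theorem3p3 (R : realType) (H : completeNormedModType R)
    (ip : {dot H for idfun}) (hip : norm_induced_by ip)
    (x0 : H) (T : H -> H) (hT : nonexpansive T) (hFix : Fix T !=set0)
    (lambda : R -> R)
    (lambda01 : forall t : R, 0 <= t -> 0 <= lambda t <= 1)
    (mlambda : lebesgue_measurable_fun [set t : R | 0 <= t] lambda)
    (lambda_inf : 0 < inf [set lambda t | t in [set t : R | 0 <= t]])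
    (x : R -> H) (hx : strong_global_solution T lambda x0 x)
    (hreg : boundedly_holder_regular T) :
  exists (xbar : H) (M gamma : R),
    [/\ Fix T xbar, 0 < M, 0 < gamma < 1 &
        {ae (@lebesgue_measure R), forall t : R, 0 <= t ->
           `|x t - xbar| <= M * t `^ (- (gamma / (2 * (1 - gamma))))}].
Proof.
move: lambda_inf; set l := inf _ => l0.
have ll u : 0 <= u -> l <= lambda u.
  move=> u0; apply: ge_inf; last by exists u.
  by exists 0 => _ [v v0 <-]; have /andP[] := lambda01 v v0.
have fejer c s t : Fix T c -> 0 <= s -> s <= t -> `|x t - c| <= `|x s - c|.
  move=> fc s0 st; rewrite -ler_sqr ?nnegrE //.
  have := strong_solution_decrease _ _ _ _ _ _ _ _ l 0 s t hip hT ll (ltW l0) hx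
    fc s0 st.
  rewrite mul0r addr0; apply => u _.
  by rewrite mulr_ge0 ?(ltW l0) ?sqr_ge0.
pose d t := dist_set (x t) (Fix T).
have d0 t : 0 <= d t by exact: dist_set_ge0.
have d_dec s t : 0 <= s -> s <= t -> d t <= d s.
  move=> s0 st; apply: le_dist_set => // c fc.
  exact: le_trans (dist_set_le _ _ _ _ _ fc) (fejer _ _ _ fc s0 st).
have [c0 fc0] := hFix.
(* Fejer monotonicity with respect to one fixed point bounds the orbit, the bounded set whose
   regularity constants give [gamma]. *)
have bU : bounded_set [set x t | t in [set t | 0 <= t]].
  exists (`|x 0 - c0| + `|c0|); split; first exact: num_real.
  move=> M /ltW hM _ [t t0 <-]; apply: le_trans hM.
  rewrite -{1}(subrK c0 (x t)); apply: le_trans (ler_normD _ _) _.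
  by rewrite lerD2r fejer.
have [kappa [gamma [k0 /andP[g0 g1] hd]]] := hreg _ bU.
pose p := gamma^-1; pose A := l / (kappa `^ p) ^+ 2.
have p1 : 1 < p by rewrite invf_gt1.
have kp0 : 0 < (kappa `^ p) ^+ 2 by rewrite exprn_gt0 ?powR_gt0.
have A0 : 0 < A by rewrite divr_gt0.
have decay s t : 0 <= s -> s <= t ->
    d t ^+ 2 + A * (d t ^+ 2) `^ p * (t - s) <= d s ^+ 2.
  move=> s0 st; set K := A * _.
  have K0 : 0 <= K * (t - s).
    by rewrite mulr_ge0 ?subr_ge0 // mulr_ge0 ?powR_ge0 ?(ltW A0).
  (* Writing the left side as the square of its root reduces the claim to a lower bound on a
     distance, which may be checked for each fixed point [c]. *)
  rewrite -(@sqr_sqrtr _ (_ + _)) ?addr_ge0 ?sqr_ge0 //.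
  rewrite ler_sqr ?nnegrE ?sqrtr_ge0 //; apply: le_dist_set => // c fc.
  rewrite -[leRHS]normr_id -sqrtr_sqr ler_sqrt ?sqr_ge0 //.
  apply: le_trans (strong_solution_decrease _ _ _ _ _ _ _ _ l K s t hip hT ll
    (ltW l0) hx fc s0 st _).
    by rewrite lerD2r ler_sqr ?nnegrE //; exact: dist_set_le.
  (* For [u <= t] monotonicity gives [d t <= d u], so the residual at [u] is bounded below in terms
     of [d t]. *)
  move=> u /andP[su ut]; have u0 := le_trans s0 su.
  rewrite /K /A -mulrA ler_pM2l // mulrC ler_pdivrMr // mulrC.
  apply: le_trans (holder_residual_ge _ _ _ _ _ k0 g0 (d0 u) (normr_ge0 _) _).
    apply: ge0_ler_powR; rewrite ?nnegrE ?sqr_ge0 ?invr_ge0 ?(ltW g0) //.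
    by rewrite ler_sqr ?nnegrE //; exact: d_dec.
  by apply: hd; exists u.
have [C C0 hC] := powR_decay _ (fun t => d t ^+ 2) A p A0 p1
  (fun t _ => sqr_ge0 _) decay.
pose rho := gamma / (2 * (1 - gamma)).
have rho0 : 0 < rho by rewrite divr_gt0 // mulr_gt0 // subr_gt0.
have drate t : 0 < t -> d t <= Num.sqrt C * t `^ (- rho).
  move=> t0; rewrite -ler_sqr ?nnegrE ?mulr_ge0 ?sqrtr_ge0 ?powR_ge0 //.
  rewrite exprMn sqr_sqrtr ?(ltW C0) //.
  (* [2 * rho = 1 / (p - 1)], since [p - 1 = (1 - gamma) / gamma]. *)
  have -> : (t `^ (- rho)) ^+ 2 = t `^ (- (p - 1)^-1); last exact: hC.
  rewrite -powR_mulrn ?powR_ge0 // -powRrM; congr powR.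
  by rewrite /rho /p; field; lra.
have dlim e : 0 < e -> exists2 t, 0 < t & d t < e.
  move=> e0; have sC0 : 0 < Num.sqrt C by rewrite sqrtr_gt0.
  have [t t0 te] := powRN_lt _ _ _ _ sC0 rho0 e0.
  by exists t => //; exact: le_lt_trans (drate t t0) te.
have [xbar hxbar] := fejer_cvg _ _ _ _ hFix fejer dlim.
exists xbar, (2 * Num.sqrt C), gamma; split.
- apply: Fix_dist0 => // e e0.
  (* The limit is within [2 * d t < 2 * e / 3] of [x t], and a fixed point lies within [e / 3] of
     [x t]. *)
  have [t t0 te] := dlim (e / 3) (divr_gt0 e0 (ltr0Sn _ _)).
  have [c fc xc] := dist_set_lt _ _ _ _ _ hFix te; exists c => //.
  apply: le_lt_trans (ler_distD (x t) _ _) _.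
  by have := hxbar t (ltW t0); rewrite distrC /d in te *; lra.
- by rewrite mulr_gt0 // sqrtr_gt0.
- by rewrite g0.
(* At [t = 0] the right-hand side is the junk value [0 `^ (- rho) = 0]. *)
exists [set 0]; split; [exact: measurable_set1|exact: lebesgue_measure_set1|].
move=> t /= nt; apply: contrapT => /eqP t0; apply: nt => t_ge0.
apply: le_trans (hxbar t t_ge0) _; rewrite -mulrA ler_pM2l //.
by apply: drate; rewrite lt_neqAle eq_sym t0.
Qed.
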